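(* Let $\Phi:[0,\ell(I)[\,\to\mathbb{R}_+$ be an error function and let $f:I\to\mathbb{R}$ be $\Phi$-monotone. Assume that both functions are locally Lebesgue integrable. Then, for every $x<y$ in $I$, the following two inequalities hold: $$f(x)-\frac{1}{y-x}\int_0^{y-x}\Phi\le\frac{1}{y-x}\int_x^y f\le f(y)+\frac{1}{y-x}\int_0^{y-x}\Phi.$$ Furthermore, if $\Phi$ is subadditive and nondecreasing, then, for all $x<y$ in $I$, $$\sup_{f}\bigg(f(x)-\frac{1}{y-x}\int_x^y f\bigg)=\sup_{f}\bigg(\frac{1}{y-x}\int_x^y f-f(y)\bigg)=\frac{1}{y-x}\int_0^{y-x}\Phi,$$ where both suprema are taken over all locally Lebesgue integrable $\Phi$-monotone functions $f:I\to\mathbb{R}$.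
   Context: $I$ is a nonempty open real interval and $\ell(I)\in\,]0,\infty]$ is its length; $\mathbb{R}_+=[0,\infty[$. An error function is any function $\Phi:[0,\ell(I)[\,\to\mathbb{R}_+$; it is subadditive if $\Phi(u+v)\le\Phi(u)+\Phi(v)$ for all $u,v\in\mathbb{R}_+$ with $u+v<\ell(I)$. A function on an interval is locally Lebesgue integrable if it has a finite Lebesgue integral over every compact subinterval of its domain. $f:I\to\mathbb{R}$ is $\Phi$-monotone if $f(x)\le f(y)+\Phi(y-x)$ for all $x,y\in I$ with $x\le y$. *)

(* Defs.v *)
From HB Require Import structures.
From mathcomp Require Import all_boot all_order all_algebra.
From mathcomp Require Import all_classical all_reals all_analysis.

Set Implicit Arguments.
Unset Strict Implicit.
Unset Printing Implicit Defensive.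

Import Order.TTheory GRing.Theory Num.Theory.
Import numFieldNormedType.Exports.

Local Open Scope classical_set_scope.
Local Open Scope ring_scope.

(* Functions defined on a subset of R are represented by functions R -> R;
   every notion below only constrains their values on the intended domain. *)

Definition nonempty_open_interval (R : realType) (I : set R) : Prop :=
  [/\ I !=set0, open I & is_interval I].

(* For nonempty I the difference is never of the form +oo - +oo. *)
Definition interval_length (R : realType) (I : set R) : \bar R :=
  (ereal_sup (EFin @` I) - ereal_inf (EFin @` I))%E.

Definition error_domain (R : realType) (I : set R) : set R :=
  [set u | 0 <= u /\ (u%:E < interval_length I)%E].

Definition error_function (R : realType) (I : set R) (Phi : R -> R) : Prop :=
  forall u, error_domain I u -> 0 <= Phi u.

Definition err_subadditive (R : realType) (I : set R) (Phi : R -> R) : Prop :=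
  forall u v, 0 <= u -> 0 <= v -> ((u + v)%:E < interval_length I)%E ->
    Phi (u + v) <= Phi u + Phi v.

Definition err_nondecreasing (R : realType) (I : set R) (Phi : R -> R) : Prop :=
  forall u v, error_domain I u -> error_domain I v -> u <= v -> Phi u <= Phi v.

Definition err_monotone (R : realType) (I : set R) (Phi f : R -> R) : Prop :=
  forall x y, I x -> I y -> x <= y -> f x <= f y + Phi (y - x).

(* lebesgue_measure lives on the Borel sets only; its completion is used so that
   measurability is Lebesgue measurability. *)
Definition locally_Lebesgue_integrable (R : realType) (D : set R) (f : R -> R) :
    Prop :=
  forall a b : R, `[a, b] `<=` D ->
    (@completed_lebesgue_measure R).-integrable `[a, b] (EFin \o f).

Definition Lebesgue_integral (R : realType) (a b : R) (f : R -> R) : R :=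
  \int[@completed_lebesgue_measure R]_(t in `[a, b]) f t.

Definition integrable_err_monotone (R : realType) (I : set R) (Phi : R -> R) :
    set (R -> R) :=
  [set f | locally_Lebesgue_integrable I f /\ err_monotone I Phi f].

(* Main.v *)
(** Averaging [f x <= f t + Phi (t - x)] and [f t <= f y + Phi (y - t)] over [t]
    in [[x, y]] yields the two inequalities, since both [Phi (t - x)] and
    [Phi (y - t)] integrate to the integral of [Phi] over [[0, y - x]].  For a
    subadditive nondecreasing [Phi] the suprema are attained, by the functions
    [t |-> - Phi (t - x)] for [t > x], [0] for [t <= x], and
    [t |-> Phi (y - t)] for [t < y], [0] for [t >= y].

    The changes of variables rest on the invariance of Lebesgue outer measure
    under the reflections [t |-> c - t]; two reflections make a translation. *)

Require Import Defs.
From HB Require Import structures.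
From mathcomp Require Import all_boot all_order all_algebra.
From mathcomp Require Import all_classical all_reals all_analysis.
From mathcomp Require Import measurable_realfun ring lra.

Set Implicit Arguments.
Unset Strict Implicit.
Unset Printing Implicit Defensive.

Import Order.TTheory GRing.Theory Num.Theory.
Import numFieldNormedType.Exports.

Local Open Scope classical_set_scope.
Local Open Scope ring_scope.

(** * Invariance of the completed Lebesgue measure under reflections and translations *)

Section completed_lebesgue_reflection.
Variable R : realType.
Local Notation cmu := (@completed_lebesgue_measure R).
(* [R] with the sigma-algebra of Lebesgue measurable sets. *)
Let cR : measurableType _ :=
  caratheodory_type ((@wlength R idfun)^*)%mu.

Definition mirror (c : R) (t : cR) : cR := c - (t : R).

Lemma mirrorK c : involutive (mirror c).
Proof. by move=> t; rewrite /mirror subKr. Qed.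

Lemma preimage_mirrorK c (X : set R) :
  mirror c @^-1` (mirror c @^-1` X) = X.
Proof. by apply/seteqP; split => t /=; rewrite mirrorK. Qed.

Lemma preimage_mirror_itv c (a b : R) (b1 b2 : bool) :
  mirror c @^-1` [set` Interval (BSide b1 a) (BSide b2 b)] =
  [set` Interval (BSide (~~ b2) (c - b)) (BSide (~~ b1) (c - a))].
Proof.
apply/seteqP; split => t /=; rewrite /mirror !in_itv /= andbC;
case: b1; case: b2 => /=; by rewrite ?lerBlDr ?lerBrDr ?ltrBlDr ?ltrBrDr
  ?(addrC a) ?(addrC b) -?lerBlDr -?lerBrDr -?ltrBlDr -?ltrBrDr.
Qed.

(* [cmu] is the restriction of the outer measure, so [X] can be an arbitrary set,
   and only the outer measures of the mirrored half-open intervals of a cover have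
   to be computed. *)
Lemma completed_lebesgue_measure_mirror c (X : set R) :
  cmu (mirror c @^-1` X) = cmu X.
Proof.
(* As [mirror c] is an involution, applying one inequality to [X] and to its mirror image gives
   both. *)
suff H Y : (cmu (mirror c @^-1` Y) <= cmu Y)%E.
  by apply/eqP; rewrite eq_le H/= -[leLHS](congr1 cmu (preimage_mirrorK c X)) H.
apply: le_ereal_inf_tmp => _ [B [mB YB] <-].
(* Mirroring a cover of [Y] gives a cover of the mirrored set. *)
apply: (@le_trans _ _ (cmu (\bigcup_k (mirror c @^-1` (B k))))).
  apply: le_mu_ext; rewrite -preimage_bigcup; exact: preimage_subset.
apply: (le_trans (outer_measure_sigma_subadditive
  ((@wlength R idfun)^*)%mu (fun k => mirror c @^-1` (B k)))).
apply: lee_nneseries => [k _ _|k _]; first exact: outer_measure_ge0.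
have [[a b] _ <-] := mB k.
(* Both measures restrict the same outer measure, so they are convertible here. The mirrored
   interval is closed on the left and open on the right, hence no longer of the form measured by
   [wlength]. *)
rewrite [leLHS](_ : _ =
  lebesgue_measure (mirror c @^-1` `]a, b] : set (measurableTypeR R)))//.
rewrite preimage_mirror_itv lebesgue_measure_itv/= wlength_itv/= !lte_fin.
by rewrite ltrD2l ltrN2 -!EFinB opprB addrCA addrAC subrr add0r addrC.
Qed.

(** By invariance of the outer measure, splitting a test set [X] along the mirrored [A] amounts to
    splitting the mirrored [X] along [A], so the Caratheodory criterion carries over. *)
Lemma measurable_mirror c : measurable_fun [set: cR] (mirror c).
Proof.
set mu := ((@wlength R idfun)^*)%mu.
have e Y : mu (mirror c @^-1` Y) = mu Y by exact: completed_lebesgue_measure_mirror.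
move=> _ A mA; rewrite setTI.
have {}mA : caratheodory_measurable mu A := mA.
move=> X; have := mA (mirror c @^-1` X); rewrite e -(e (_ `&` A)) -(e (_ `&` ~` A)).
by rewrite !preimage_setI preimage_setC preimage_mirrorK.
Qed.

(** The pushforward of [cmu] under [mirror c] is [cmu] itself. *)
Lemma ge0_integral_mirror c (D : set cR) (f : cR -> \bar R) :
  measurable D -> measurable_fun D f -> {in D, forall t, 0 <= f t}%E ->
  (\int[cmu]_(t in mirror c @^-1` D) f (mirror c t) = \int[cmu]_(t in D) f t)%E.
Proof.
move=> mD mf f0; rewrite -(ge0_integral_pushforward (measurable_mirror c))//.
apply: eq_measure_integral; first exact: measurable_mirror.
by move=> mr A mA _; exact: (completed_lebesgue_measure_mirror c A).
Qed.

Lemma integrable_mirror c (D : set cR) (f : cR -> \bar R) :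
  measurable D -> cmu.-integrable D f ->
  cmu.-integrable (mirror c @^-1` D) (f \o mirror c).
Proof.
move=> mD /integrableP[mf fi]; apply/integrableP; split.
  apply: (measurable_comp mD) => //; first by move=> _ [t Dt <-].
  exact: measurable_funTS (measurable_mirror c).
rewrite (@ge0_integral_mirror c D (fun t => `|f t|%E))//.
exact: measurableT_comp.
Qed.

Lemma integral_mirror c (D : set cR) (f : cR -> \bar R) :
  measurable D -> measurable_fun D f ->
  (\int[cmu]_(t in mirror c @^-1` D) f (mirror c t) = \int[cmu]_(t in D) f t)%E.
Proof.
move=> mD mf; rewrite integralE [RHS]integralE; congr (_ - _)%E.
  rewrite -(@ge0_integral_mirror c D (f^\+)%E)//; last exact: measurable_funepos.
  by apply: eq_integral => t _; rewrite !funeposE.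
rewrite -(@ge0_integral_mirror c D (f^\-)%E)//; last exact: measurable_funeneg.
by apply: eq_integral => t _; rewrite !funenegE.
Qed.

Lemma borel_completed_measurable (A : set R) :
  measurable A -> measurable (A : set cR).
Proof. exact: sub_caratheodory. Qed.

Lemma measurable_itv_completed (i : interval R) :
  measurable ([set` i] : set cR).
Proof.
apply: borel_completed_measurable; exact: measurable_itv.
Qed.

Lemma integrable_itv_reflect (c a b : R) (f : R -> R) :
  cmu.-integrable `[a, b] (EFin \o f) ->
  cmu.-integrable `[c - b, c - a] (EFin \o (fun t => f (c - t))).
Proof.
move=> fi; have := integrable_mirror c (measurable_itv_completed _) fi.
by rewrite preimage_mirror_itv.
Qed.

Lemma Lebesgue_integral_reflect (c a b : R) (f : R -> R) :
  cmu.-integrable `[a, b] (EFin \o f) ->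
  Lebesgue_integral (c - b) (c - a) (fun t => f (c - t)) =
  Lebesgue_integral a b f.
Proof.
move=> /measurable_int mf; rewrite /Lebesgue_integral /Rintegral.
rewrite -(integral_mirror c (measurable_itv_completed _) mf).
by rewrite preimage_mirror_itv.
Qed.

Lemma integrable_itv_shift (c a b : R) (f : R -> R) :
  cmu.-integrable `[a, b] (EFin \o f) ->
  cmu.-integrable `[a + c, b + c] (EFin \o (fun t => f (t - c))).
Proof.
(* The translation arises as [0 - (c - t) = t - c]. *)
move=> /(integrable_itv_reflect 0)/(integrable_itv_reflect c).
rewrite !sub0r !opprK ![c + _]addrC.
by under [EFin \o _]funext do rewrite /= sub0r opprB.
Qed.

Lemma Lebesgue_integral_shift (c a b : R) (f : R -> R) :
  cmu.-integrable `[a, b] (EFin \o f) ->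
  Lebesgue_integral (a + c) (b + c) (fun t => f (t - c)) =
  Lebesgue_integral a b f.
Proof.
move=> fi; rewrite -(Lebesgue_integral_reflect 0 fi).
rewrite -(Lebesgue_integral_reflect c (integrable_itv_reflect 0 fi)).
rewrite !sub0r !opprK ![c + _]addrC.
by congr Lebesgue_integral; apply/funext => t; rewrite sub0r opprB.
Qed.

Lemma completed_lebesgue_measure_itv_cc (a b : R) : a <= b ->
  cmu `[a, b] = (b - a)%:E.
Proof.
move=> ab; rewrite [LHS](_ : _ = lebesgue_measure (`[a, b] : set R))//.
rewrite lebesgue_measure_itv/= lte_fin; case: ltgtP ab => // -> _.
by rewrite subrr.
Qed.

Lemma Lebesgue_integral_cst (a b k : R) : a <= b ->
  Lebesgue_integral a b (fun=> k) = k * (b - a).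
Proof.
move=> ab; rewrite /Lebesgue_integral Rintegral_cst; last first.
  exact: measurable_itv_completed.
congr (_ * _); exact: (congr1 fine (completed_lebesgue_measure_itv_cc ab)).
Qed.

Lemma integrable_itv_cst (a b k : R) :
  cmu.-integrable `[a, b] (EFin \o (fun=> k)).
Proof.
have mI := measurable_itv_completed `[a, b].
apply: measurable_bounded_integrable => //.
  have [ab|ba] := leP a b.
    by apply: (@le_lt_trans _ _ (b - a)%:E); rewrite ?ltry// -completed_lebesgue_measure_itv_cc.
  by rewrite set_itv_ge ?measure0// bnd_simp -ltNge.
exact: bounded_cst.
Qed.

(** A point is null; this absorbs the endpoint where the extremal functions are set to [0]. *)
Lemma Rintegral_setD1 (D : set cR) (p : cR) (f : cR -> R) :
  measurable D -> cmu.-integrable D (EFin \o f) ->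
  \int[cmu]_(t in D `\ p) f t = \int[cmu]_(t in D) f t.
Proof.
move=> mD fi; rewrite /Rintegral -negligible_integral//.
  apply: borel_completed_measurable; exact: measurable_set1.
exact: (lebesgue_measure_set1 p).
Qed.

End completed_lebesgue_reflection.

(** * Mean value bounds for [Phi]-monotone functions *)

Section err_monotone_mean.
Variables (R : realType) (I : set R) (Phi : R -> R).
Hypothesis hI : nonempty_open_interval I.
Local Notation cmu := (@completed_lebesgue_measure R).

Lemma itv_cc_sub (x y : R) : I x -> I y -> `[x, y] `<=` I.
Proof.
by case: hI => _ _ iI Ix Iy t /=; rewrite in_itv/=; exact: iI.
Qed.

(** Strictness comes from openness: [y] can be pushed slightly to the right inside [I]. This puts
    [y - x] in the domain of [Phi]. *)
Lemma sub_lt_interval_length (x y : R) : I x -> I y ->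
  ((y - x)%:E < interval_length I)%E.
Proof.
move=> Ix Iy; have [_ oI _] := hI.
have [e /= e0 ye] : \forall e \near 0^'+, I (y + e).
  have : (fun e : R => y + e) @ 0^'+ --> y.
    rewrite -[X in _ --> X]addr0; apply: cvgD; first exact: cvg_cst.
    exact: cvg_within_filter.
  by apply; exact: open_nbhs_nbhs.
have Iye : I (y + e / 2).
  apply: ye; rewrite /= ?divr_gt0//.
  by rewrite sub0r normrN gtr0_norm ?divr_gt0// gtr_pMr// invf_lt1// ltr1n.
apply: (@lt_le_trans _ _ (y + e / 2 - x)%:E).
  by rewrite lte_fin ltrD2r ltrDl divr_gt0.
rewrite EFinB; apply: leeB.
  by apply: ereal_sup_ubound; exists (y + e / 2).
by apply: ereal_inf_lbound; exists x.
Qed.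

Lemma error_domain_itv_cc (x y : R) : I x -> I y ->
  `[0, y - x] `<=` error_domain I.
Proof.
move=> Ix Iy u; rewrite /= in_itv/= => /andP[u0 uyx]; split=> //.
by rewrite (le_lt_trans _ (sub_lt_interval_length Ix Iy))// lee_fin.
Qed.

Hypothesis iPhi : locally_Lebesgue_integrable (error_domain I) Phi.

Lemma integrable_Phi_shift (x y : R) : I x -> I y ->
  cmu.-integrable `[x, y] (EFin \o (fun t => Phi (t - x))).
Proof.
move=> Ix Iy.
have := integrable_itv_shift x (iPhi (error_domain_itv_cc Ix Iy)).
by rewrite add0r subrK.
Qed.

Lemma integral_Phi_shift (x y : R) : I x -> I y ->
  Lebesgue_integral x y (fun t => Phi (t - x)) = Lebesgue_integral 0 (y - x) Phi.
Proof.
move=> Ix Iy.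
have := Lebesgue_integral_shift x (iPhi (error_domain_itv_cc Ix Iy)).
by rewrite add0r subrK.
Qed.

Lemma integrable_Phi_reflect (x y : R) : I x -> I y ->
  cmu.-integrable `[x, y] (EFin \o (fun t => Phi (y - t))).
Proof.
move=> Ix Iy.
have := integrable_itv_reflect y (iPhi (error_domain_itv_cc Ix Iy)).
by rewrite subr0 subKr.
Qed.

Lemma integral_Phi_reflect (x y : R) : I x -> I y ->
  Lebesgue_integral x y (fun t => Phi (y - t)) = Lebesgue_integral 0 (y - x) Phi.
Proof.
move=> Ix Iy.
have := Lebesgue_integral_reflect y (iPhi (error_domain_itv_cc Ix Iy)).
by rewrite subr0 subKr.
Qed.

Lemma mean_bounds (f : R -> R) :
  err_monotone I Phi f -> locally_Lebesgue_integrable I f ->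
  forall x y : R, I x -> I y -> x < y ->
    f x - (y - x)^-1 * Lebesgue_integral 0 (y - x) Phi
      <= (y - x)^-1 * Lebesgue_integral x y f
    /\
    (y - x)^-1 * Lebesgue_integral x y f
      <= f y + (y - x)^-1 * Lebesgue_integral 0 (y - x) Phi.
Proof.
move=> mf fi x y Ix Iy xy.
have yx0 : 0 < y - x by rewrite subr_gt0.
have sI := itv_cc_sub Ix Iy.
have fxy := fi _ _ sI.
have mxy := measurable_itv_completed `[x, y].
have Pl := integrable_Phi_shift Ix Iy.
have Pr := integrable_Phi_reflect Ix Iy.
split.
- rewrite lerBlDr -mulrDr -(integral_Phi_shift Ix Iy) ler_pdivlMl//.
  (* Once the denominator is cleared, [f x] times [y - x] is the integral of a constant, and a
     pointwise inequality under the integral suffices. *)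
  rewrite mulrC -(Lebesgue_integral_cst _ (ltW xy)).
  rewrite /Lebesgue_integral -RintegralD//; apply: le_Rintegral => //.
  + exact: integrable_itv_cst.
  + exact: (integrableD mxy fxy Pl).
  + move=> t txy; apply: mf => //; first exact: sI.
    by move: txy; rewrite /= in_itv/= => /andP[].
- rewrite ler_pdivrMl// mulrDr mulVKf ?gt_eqF// -(integral_Phi_reflect Ix Iy).
  rewrite mulrC -(Lebesgue_integral_cst _ (ltW xy)).
  rewrite /Lebesgue_integral -RintegralD//; last exact: integrable_itv_cst.
  apply: le_Rintegral => //.
  + exact: (integrableD mxy (integrable_itv_cst _ _ _) Pr).
  + move=> t txy; apply: mf => //; first exact: sI.
    by move: txy; rewrite /= in_itv/= => /andP[].
Qed.

(** * Extremal functions for a subadditive nondecreasing [Phi] *)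

Hypothesis hPhi : error_function I Phi.
Hypothesis sPhi : err_subadditive I Phi.
Hypothesis nPhi : err_nondecreasing I Phi.

Lemma error_domain_sub (x y : R) : I x -> I y -> x <= y ->
  error_domain I (y - x).
Proof.
by move=> Ix Iy xy; split; [rewrite subr_ge0|exact: sub_lt_interval_length].
Qed.

(* [Phi 0] may be positive: the value [0] at [t = x] (resp. [t = y]) is what makes
   the bounds of [mean_bounds] equalities. *)
Definition extremal_left (x t : R) : R := if x < t then - Phi (t - x) else 0.

Definition extremal_right (y t : R) : R := if t < y then Phi (y - t) else 0.

(** As a restriction to a half-line, the function can be integrated over an intersection of
    intervals. *)
Lemma extremal_left_patch x :
  extremal_left x = (fun t => - Phi (t - x)) \_ `]x, +oo[.
Proof. by apply/funext => t; rewrite /patch mem_setE in_itv/= andbT. Qed.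

Lemma extremal_right_patch y :
  extremal_right y = (fun t => Phi (y - t)) \_ `]-oo, y[.
Proof. by apply/funext => t; rewrite /patch mem_setE in_itv/=. Qed.

(** For [s <= t]: subadditivity when [x < s]; monotonicity of [Phi] when [s <= x < t], as
    [t - x <= t - s]; nonnegativity when [t <= x]. *)
Lemma extremal_left_err_monotone x : I x ->
  err_monotone I Phi (extremal_left x).
Proof.
move=> Ix s t Is It st; rewrite /extremal_left.
have P0 := hPhi (error_domain_sub Is It st).
have [xs|sx] := ltP x s.
  rewrite (lt_le_trans xs st).
  have := @sPhi (s - x) (t - s).
  rewrite !subr_ge0 (_ : s - x + (t - s) = t - x); last by ring.
  move=> /(_ (ltW xs) st (sub_lt_interval_length Ix It)); lra.
case: ltP => xt; last by rewrite add0r.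
have := nPhi (error_domain_sub Ix It (ltW xt)) (error_domain_sub Is It st).
by rewrite lerD2l lerN2 => /(_ sx); lra.
Qed.

(** The same three cases around [y]: subadditivity when [t < y], monotonicity when [s < y <= t],
    nonnegativity when [y <= s]. *)
Lemma extremal_right_err_monotone y : I y ->
  err_monotone I Phi (extremal_right y).
Proof.
move=> Iy s t Is It st; rewrite /extremal_right.
have P0 := hPhi (error_domain_sub Is It st).
have [ty|yt] := ltP t y.
  rewrite (le_lt_trans st ty).
  have := @sPhi (y - t) (t - s).
  rewrite !subr_ge0 (_ : y - t + (t - s) = y - s); last by ring.
  by move=> /(_ (ltW ty) st (sub_lt_interval_length Is Iy)).
case: ltP => sy; last by rewrite add0r.
have := nPhi (error_domain_sub Is Iy (ltW sy)) (error_domain_sub Is It st).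
by rewrite lerD2r add0r; apply.
Qed.

Lemma extremal_left_integrable x : I x ->
  locally_Lebesgue_integrable I (extremal_left x).
Proof.
move=> Ix a b abI; have [ab|ba] := leP a b; last first.
  by rewrite set_itv_ge ?bnd_simp -?ltNge//; exact: integrable_set0.
have Ib : I b by apply: abI; rewrite /= in_itv/= ab lexx.
rewrite extremal_left_patch -restrict_EFin.
apply/integrable_restrict; do ?exact: measurable_itv_completed.
(* The part of [[a, b]] beyond [x] lies in [[x, b]], whose endpoints are both in [I], so the shifted
   [Phi] is integrable there. *)
apply: (integrableS (measurable_itv_completed `[x, b])).
- by apply: measurableI; exact: measurable_itv_completed.
- by move=> t /= []; rewrite !in_itv/= => /andP[_ ->]; rewrite andbT => /ltW ->.
exact: (integrableN (integrable_Phi_shift Ix Ib)).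
Qed.

Lemma extremal_right_integrable y : I y ->
  locally_Lebesgue_integrable I (extremal_right y).
Proof.
move=> Iy a b abI; have [ab|ba] := leP a b; last first.
  by rewrite set_itv_ge ?bnd_simp -?ltNge//; exact: integrable_set0.
have Ia : I a by apply: abI; rewrite /= in_itv/= ab lexx.
rewrite extremal_right_patch -restrict_EFin.
apply/integrable_restrict; do ?exact: measurable_itv_completed.
apply: (integrableS (measurable_itv_completed `[a, y])).
- by apply: measurableI; exact: measurable_itv_completed.
- by move=> t /= []; rewrite !in_itv/= => /andP[-> _] /ltW ->.
exact: integrable_Phi_reflect.
Qed.

Lemma integral_extremal_left x y : I x -> I y -> x < y ->
  Lebesgue_integral x y (extremal_left x) = - Lebesgue_integral 0 (y - x) Phi.
Proof.
move=> Ix Iy xy; rewrite -(integral_Phi_shift Ix Iy) /Lebesgue_integral.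
rewrite extremal_left_patch.
have mxy := measurable_itv_completed `[x, y].
have iP := integrable_Phi_shift Ix Iy.
(* On [[x, y]] the function differs from [- Phi (t - x)] at most at [t = x]. *)
rewrite -Rintegral_mkcondr (_ : _ `&` _ = `[x, y] `\ x); last first.
  apply/seteqP; split => t /=; rewrite !in_itv/= andbT.
    by move=> [-> xt]; split => // tx; rewrite tx ltxx in xt.
  by move=> [/andP[xt ->] /eqP tx]; rewrite xt lt_neqAle eq_sym tx.
rewrite Rintegral_setD1//; last exact: (integrableN iP).
rewrite -[RHS]mulN1r -[RHS]RintegralZl//.
by apply: eq_Rintegral => t _; rewrite mulN1r.
Qed.

Lemma integral_extremal_right x y : I x -> I y -> x < y ->
  Lebesgue_integral x y (extremal_right y) = Lebesgue_integral 0 (y - x) Phi.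
Proof.
move=> Ix Iy xy; rewrite -(integral_Phi_reflect Ix Iy) /Lebesgue_integral.
rewrite extremal_right_patch.
have mxy := measurable_itv_completed `[x, y].
have iP := integrable_Phi_reflect Ix Iy.
rewrite -Rintegral_mkcondr (_ : _ `&` _ = `[x, y] `\ y); last first.
  apply/seteqP; split => t /=; rewrite !in_itv/=.
    by move=> [-> xt]; split => // tx; rewrite tx ltxx in xt.
  by move=> [/andP[-> ty] /eqP yt]; rewrite ty lt_neqAle yt.
by rewrite Rintegral_setD1.
Qed.

End err_monotone_mean.

Theorem theorem5p2 (R : realType) (I : set R) (Phi : R -> R)
    (hI : nonempty_open_interval I)
    (hPhi : error_function I Phi)
    (iPhi : locally_Lebesgue_integrable (error_domain I) Phi) :
  (forall f : R -> R,
     err_monotone I Phi f ->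
     locally_Lebesgue_integrable I f ->
     forall x y : R, I x -> I y -> x < y ->
       f x - (y - x)^-1 * Lebesgue_integral 0 (y - x) Phi
         <= (y - x)^-1 * Lebesgue_integral x y f
       /\
       (y - x)^-1 * Lebesgue_integral x y f
         <= f y + (y - x)^-1 * Lebesgue_integral 0 (y - x) Phi)
  /\
  (err_subadditive I Phi -> err_nondecreasing I Phi ->
     forall x y : R, I x -> I y -> x < y ->
       ereal_sup [set (f x - (y - x)^-1 * Lebesgue_integral x y f)%:E
                 | f in integrable_err_monotone I Phi]
       = ereal_sup [set ((y - x)^-1 * Lebesgue_integral x y f - f y)%:E
                   | f in integrable_err_monotone I Phi]
       /\
       ereal_sup [set ((y - x)^-1 * Lebesgue_integral x y f - f y)%:E
                 | f in integrable_err_monotone I Phi]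
       = ((y - x)^-1 * Lebesgue_integral 0 (y - x) Phi)%:E).
Proof.
split; first exact: mean_bounds.
move=> sPhi nPhi x y Ix Iy xy.
have bounds f : integrable_err_monotone I Phi f -> _ :=
  fun fI => mean_bounds hI iPhi fI.2 fI.1 Ix Iy xy.
(* Terms under the binder [f] cannot match, so [v] is the mean of [Phi]. *)
set v := (X in X%:E).
have -> : ereal_sup [set (f x - (y - x)^-1 * Lebesgue_integral x y f)%:E
                    | f in integrable_err_monotone I Phi] = v%:E.
  apply/eqP; rewrite eq_le; apply/andP; split.
    apply: ge_ereal_sup => _ [f /bounds[lef _] <-].
    by rewrite lee_fin lerBlDr addrC -lerBlDr.
  (* The bound is attained: this function vanishes at [x] and has mean [- v] over [[x, y]]. *)
  apply: ereal_sup_ubound; exists (extremal_left Phi x).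
    by split; [exact: extremal_left_integrable|exact: extremal_left_err_monotone].
  rewrite (integral_extremal_left hI iPhi)// /extremal_left ltxx.
  by rewrite mulrN sub0r opprK.
suff -> : ereal_sup [set ((y - x)^-1 * Lebesgue_integral x y f - f y)%:E
                    | f in integrable_err_monotone I Phi] = v%:E by [].
apply/eqP; rewrite eq_le; apply/andP; split.
  apply: ge_ereal_sup => _ [f /bounds[_ gef] <-].
  by rewrite lee_fin lerBlDl.
(* Here the value at [y] is [0] and the mean is [v]. *)
apply: ereal_sup_ubound; exists (extremal_right Phi y).
  by split; [exact: extremal_right_integrable|exact: extremal_right_err_monotone].
by rewrite (integral_extremal_right hI iPhi)// /extremal_right ltxx subr0.
Qed.
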